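(* Let $2\le y\le x$, and let $h$ be a positive odd integer with $h\le y$. Then $$B_h(x;y)\ll\frac{x}{y}+x^{1/2}+\frac{x\log x}{y}+\frac{x(\log y)^2}{y}+\sum_{y<p\le(2xy)^{1/2}}\Psi_\tau\!\left(\frac{2xy}{p^2},p\right),$$ where the sum is over primes $p$ and the implied constant is absolute.
   Context: $\varphi$ is Euler's totient function; $P^+(m)$ is the largest prime factor of $m$, with $P^+(1)=1$; $\tau(m)$ is the number of positive divisors of $m$. $B_h(x;y)$ denotes the number of positive integers $n\le x$ with $\varphi(n)=\varphi(n+h)$ and $P^+(\varphi(n))>y$. For real $X,R$, $\Psi_\tau(X,R)=\sum_{m\le X,\ P^+(m)\le R}\tau(m)$ (sum over positive integers $m$). *)

(* Defs.v *)
From HB Require Import structures.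
From mathcomp Require Import all_boot all_order all_algebra.
From mathcomp Require Import reals exp.
Set Implicit Arguments.
Unset Strict Implicit.
Unset Printing Implicit Defensive.
Import Order.TTheory GRing.Theory Num.Theory.
Local Open Scope ring_scope.

(* In MathComp max_pdiv m is P^+(m), with max_pdiv 1 = 1, and Num.truncn x is
   the integer part of x when 0 <= x and is 0 when x < 0, so that the index
   range 1 <= n < (Num.truncn x).+1 is that of the positive integers n <= x. *)

Definition tau (m : nat) : nat := size (divisors m).

Definition B (R : realType) (h : nat) (x y : R) : nat :=
  (\sum_(1 <= n < (Num.truncn x).+1 |
      (totient n == totient (n + h)) &&
      (y < (max_pdiv (totient n))%:R)%R) 1)%N.

Definition Psi_tau (R : realType) (X r : R) : nat :=
  (\sum_(1 <= m < (Num.truncn X).+1 | ((max_pdiv m)%:R <= r)%R) tau m)%N.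

(* Main.v *)
(* Let p > y be the largest prime factor of totient n = totient (n + h). Unless
   n or n + h is divisible by d^2 for some d >= p, there are primes
   q = p k + 1 | n and q' = p k' + 1 | n + h, with k, k' p-smooth and q <> q'
   because h <= y < q. If q q' <= 2 x y, the Chinese remainder theorem leaves at
   most x / (q q') + 1 values of n; the terms 1 add up to the sum of Psi_tau,
   and the terms x / (q q') to at most x (S p / p)^2 for each p, where S p is
   the sum of 1 / k over p-smooth k and S p << log p. If q q' > 2 x y, the
   cofactors m = n / q and m' = (n + h) / q' satisfy m m' <= x / y, and the
   equation totient n = totient (n + h) is linear in n for given m and m'. It
   determines n unless totient m / m = totient m' / m', in which case m and m'
   have the same prime factors, whereas exactly one of them is even. *)
Require Import Defs.
From HB Require Import structures.
From mathcomp Require Import all_boot all_order all_algebra.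
From mathcomp Require Import reals exp.
From mathcomp Require Import ring lra zify.
Set Implicit Arguments.
Unset Strict Implicit.
Unset Printing Implicit Defensive.
Import Order.TTheory GRing.Theory Num.Theory.

(** * Prime factors of totients *)

(** A prime dividing the product of the factors [(q - 1) * q ^ (v - 1)], over the prime powers
    [q ^ v] exactly dividing [n], divides some [q - 1], or else equals some [q] with [v >= 2]. *)
Lemma prime_dvd_totient (p n : nat) : prime p -> 0 < n -> p %| totient n ->
  p ^ 2 %| n \/ exists q, [/\ prime q, q %| n & p %| q.-1].
Proof.
move=> p_pr n_gt0; rewrite totientE //.
have sub q : q \in primes n -> prime q && (q %| n).
  by rewrite mem_primes => /and3P[-> _ ->].
elim: (primes n) sub => [|q s IH] sub.
  by rewrite big_nil Euclid_dvd1.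
have /andP[q_pr q_dvd] := sub q (mem_head q s).
rewrite big_cons !Euclid_dvdM // => /orP[/orP[pq1|]|].
- by right; exists q.
- rewrite Euclid_dvdX // => /andP[]; rewrite dvdn_prime2 // => /eqP-> lq.
  by left; rewrite pfactor_dvdn //; case: (logn q n) lq => [|[]].
- by apply: IH => r rs; apply: sub; rewrite inE rs orbT.
Qed.

Lemma dvdn_max_pdiv (p n : nat) : prime p -> 0 < n -> p %| n -> p <= max_pdiv n.
Proof. by move=> p_pr n0 pn; apply: max_pdiv_max; rewrite mem_primes p_pr n0. Qed.

Lemma leq_max_pdiv (k z : nat) : 0 < z ->
  (forall p, prime p -> p %| k -> p <= z) -> max_pdiv k <= z.
Proof.
move=> z0 kz; have [k1|] := ltnP 1 k.
  by apply: kz; [apply: max_pdiv_prime|apply: max_pdiv_dvd].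
by case: k kz => [|[]].
Qed.

Lemma max_pdiv_dvdn (d n : nat) : 0 < n -> d %| n -> max_pdiv d <= max_pdiv n.
Proof.
move=> n0 dn; apply: leq_max_pdiv; first exact: max_pdiv_gt0.
by move=> p p_pr pd; apply: dvdn_max_pdiv => //; apply: dvdn_trans dn.
Qed.

(* Induction on the largest prime factor: it is the only prime whose valuation
   in [m] can exceed its valuation in [totient m]. *)
Lemma totient_ratio_primes (m m' : nat) : 0 < m -> 0 < m' ->
  totient m * m' = totient m' * m ->
  forall r, prime r -> (r %| m) = (r %| m').
Proof.
have [N] := ubnP (m + m'); elim: N m m' => // N IH m m'.
wlog le_m : m m' / max_pdiv m' <= max_pdiv m.
  move=> H mN m0 m'0 E r r_pr; have [le|/ltnW le] := leqP (max_pdiv m') (max_pdiv m).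
    exact: H.
  by rewrite (H m' m) // addnC.
move=> mN m0 m'0 E r r_pr.
have [m1|m_le1] := ltnP 1 m; last first.
  have m1 : m = 1 by lia.
  suff -> : m' = 1 by rewrite m1.
  case: (ltnP 1 m') => [/max_pdiv_prime/prime_gt1|]; last by lia.
  by move: le_m; rewrite m1 [X in _ <= X](_ : _ = 1) //; lia.
have P_pr := max_pdiv_prime m1; have P_dvd := max_pdiv_dvd m.
have P_max q : prime q -> q %| m -> q <= max_pdiv m by move=> *; apply: dvdn_max_pdiv.
move: (max_pdiv m) P_pr P_dvd P_max {le_m} => P P_pr P_dvd P_max.
have a0 : 0 < logn P m by rewrite logn_gt0 mem_primes P_pr m0.
have [u cPu Em] := pfactor_coprime P_pr m0.
have u0 : 0 < u by move: m0; rewrite Em muln_gt0 => /andP[].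
have P1 := prime_gt1 P_pr.
have Etm : totient m = totient u * (P.-1 * P ^ (logn P m).-1).
  by rewrite {1}Em totient_coprime ?totient_pfactor // coprime_sym coprimeXl.
have Pa : P ^ logn P m = P * P ^ (logn P m).-1 by rewrite -expnS prednK.
have [Pm'|nPm'] := boolP (P %| m'); last first.
  (* If [P] does not divide [m'], the equation makes [P] divide [totient m] as often as [m]. But
     [P ^ a] contributes only [a - 1] factors to it, and [totient u] none: a prime [q] dividing [u]
     with [P] dividing [q - 1] would exceed [P]. *)
  have : P %| totient u * P.-1 * m'.
    have X0 : 0 < P ^ (logn P m).-1 by rewrite expn_gt0 prime_gt0.
    rewrite -(dvdn_pmul2r X0).
    have -> : totient u * P.-1 * m' * P ^ (logn P m).-1 = totient m * m'.
      by rewrite Etm; ring.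
    by rewrite E {2}Em Pa; apply/dvdnP; exists (totient m' * u); ring.
  rewrite !Euclid_dvdM // (negPf nPm') orbF => /orP[|/dvdn_leq]; last first.
    by move: P1; clear; lia.
  case/(prime_dvd_totient P_pr u0) => [P2u|[q [q_pr qu /dvdn_leq Pq]]].
    have : P %| u by apply: dvdn_trans P2u; rewrite dvdn_exp.
    by move: cPu; rewrite prime_coprime // => /negPf->.
  have : q <= P.
    by apply: P_max => //; apply: dvdn_trans qu _; rewrite Em dvdn_mulr.
  by move: Pq (prime_gt1 q_pr); clear; lia.
have b0 : 0 < logn P m' by rewrite logn_gt0 mem_primes P_pr m'0.
have [v cPv Em'] := pfactor_coprime P_pr m'0.
have v0 : 0 < v by move: m'0; rewrite Em' muln_gt0 => /andP[].
have Etm' : totient m' = totient v * (P.-1 * P ^ (logn P m').-1).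
  by rewrite {1}Em' totient_coprime ?totient_pfactor // coprime_sym coprimeXl.
have Pb : P ^ logn P m' = P * P ^ (logn P m').-1 by rewrite -expnS prednK.
rewrite Em Em' !Euclid_dvdM // !Euclid_dvdX // a0 b0; congr (_ || _).
have ltu : u < m by rewrite Em ltn_Pmulr // -{1}(expn0 P) ltn_exp2l.
have ltv : v < m' by rewrite Em' ltn_Pmulr // -{1}(expn0 P) ltn_exp2l.
apply: (IH u v) => //; first by move: mN ltu ltv; clear; lia.
(* The powers of [P] and the factors [P - 1] cancel, so [u] and [v] satisfy the same equation. *)
have D0 : 0 < P.-1 * P ^ (logn P m).-1 * (P * P ^ (logn P m').-1).
  by rewrite !muln_gt0 !expn_gt0; move: P1; clear; case: P => [|[]].
apply/eqP; rewrite -(eqn_pmul2r D0); apply/eqP.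
move: E Em Em'; rewrite Etm Etm' Pa Pb.
move: (P ^ (logn P m).-1) (P ^ (logn P m').-1) => A B E Em Em'.
by transitivity (totient u * (P.-1 * A) * m'); [rewrite Em'|rewrite E Em]; ring.
Qed.

(** Take a prime [q = p * k + 1] dividing [n]. If [q ^ 2] divides [n], then [d = q] serves;
    otherwise [q] is coprime to the cofactor [m] and the totient splits. *)
Lemma totient_large_prime_cofactor (p n : nat) : prime p -> 0 < n ->
  p %| totient n ->
  (exists2 d, p <= d & d ^ 2 %| n) \/
  exists k m, [/\ n = (p * k + 1) * m, prime (p * k + 1), 0 < k &
                  totient n = p * k * totient m].
Proof.
move=> p_pr n0 /(prime_dvd_totient p_pr n0)[p2n|[q [q_pr qn pq]]].
  by left; exists p.
have [k Ek] := dvdnP pq.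
have q1 := prime_gt1 q_pr.
have k0 : 0 < k by case: k Ek => //; lia.
have Eq : q = p * k + 1 by lia.
have [m Em] := dvdnP qn.
have [q2|q2] := boolP (q %| m).
  left; exists q; first by have := prime_gt1 p_pr; nia.
  by have [l El] := dvdnP q2; rewrite Em El; apply/dvdnP; exists l; ring.
right; exists k, m; rewrite -Eq; split=> //; first by rewrite Em mulnC.
rewrite Em totient_coprime ?(totient_prime q_pr); first by rewrite Ek; ring.
by rewrite coprime_sym prime_coprime.
Qed.

(** * Counting *)

Lemma count_inj_sub (P Q : pred nat) (f : nat -> nat) (a b a' b' : nat) :
  (forall i, a <= i < b -> P i -> (a' <= f i < b') && Q (f i)) ->
  (forall i j, a <= i < b -> a <= j < b -> P i -> P j -> f i = f j -> i = j) ->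
  \sum_(a <= i < b | P i) 1 <= \sum_(a' <= i < b' | Q i) 1.
Proof.
move=> fQ f_inj; rewrite -!(big_filter (index_iota _ _)) !sum1_size.
set s := filter P _.
have sP i : i \in s -> P i /\ a <= i < b.
  by rewrite mem_filter mem_index_iota => /andP[].
rewrite -(size_map f); apply: uniq_leq_size.
  rewrite map_inj_in_uniq; first exact/filter_uniq/iota_uniq.
  by move=> i j /sP[Pi Hi] /sP[Pj Hj]; apply: f_inj.
by move=> _ /mapP[i /sP[Pi Hi] ->]; rewrite mem_filter mem_index_iota andbC fQ.
Qed.

Lemma count_inj_leq (P : pred nat) (f : nat -> nat) (a b K : nat) :
  (forall i, a <= i < b -> P i -> f i < K) ->
  (forall i j, a <= i < b -> a <= j < b -> P i -> P j -> f i = f j -> i = j) ->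
  \sum_(a <= i < b | P i) 1 <= K.
Proof.
move=> fK f_inj; have <- : \sum_(0 <= i < K) 1 = K.
  by rewrite sum_nat_const_nat subn0 muln1.
by apply: count_inj_sub f_inj => i iab Pi; rewrite fK.
Qed.

Lemma count_dvd_leq (D h X : nat) : 0 < D ->
  \sum_(1 <= n < X.+1 | D %| n + h) 1 <= (X + h) %/ D.
Proof.
(* The quotients are positive, so they can be shifted down by one; this saves a term 1 for every
   [D]. *)
move=> D0; apply: (count_inj_leq (f := fun n => ((n + h) %/ D).-1)).
  move=> n nX /dvdn_leq le.
  have : n + h <= X + h by lia.
  have : 0 < (n + h) %/ D by rewrite divn_gt0 //; apply: le; lia.
  by move=> H /(leq_div2r D); lia.
move=> i j Hi Hj Di Dj E.
have i0 : 0 < (i + h) %/ D by rewrite divn_gt0 // dvdn_leq //; lia.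
have j0 : 0 < (j + h) %/ D by rewrite divn_gt0 // dvdn_leq //; lia.
apply/eqP; rewrite -(eqn_add2r h) -(divnK Di) -(divnK Dj); apply/eqP.
by congr (_ * _); lia.
Qed.

(** The two conditions fix [n] modulo [q * q'], so the quotient by [q * q'], which ranges from 0,
    determines [n]. *)
Lemma count_crt_leq (q q' h X : nat) : 0 < q -> 0 < q' -> coprime q q' ->
  \sum_(1 <= n < X.+1 | (q %| n) && (q' %| n + h)) 1 <= (X %/ (q * q')).+1.
Proof.
move=> q0 q'0 cqq; apply: (count_inj_leq (f := fun n => n %/ (q * q'))).
  by move=> n nX _; rewrite ltnS leq_div2r //; lia.
move=> i j _ _ /andP[qi qi'] /andP[qj qj'] E.
rewrite (divn_eq i (q * q')) (divn_eq j (q * q')) E; congr (_ + _).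
apply/eqP; rewrite -/(i == j %[mod q * q']) chinese_remainder //.
rewrite -(eqn_modDr h i j q').
by move: qi qi' qj qj'; rewrite /dvdn => /eqP-> /eqP-> /eqP-> /eqP->; rewrite !eqxx.
Qed.

Lemma count_linear_leq1 (a b c d X : nat) : a != b ->
  \sum_(1 <= n < X | n * a + c == n * b + d) 1 <= 1.
Proof.
move=> ab; apply: (count_inj_leq (f := fun=> 0)) => // i j _ _.
move=> /eqP Ei /eqP Ej _; nia.
Qed.

(** * The shape of a solution, and the union bound over the possible shapes *)

(** The two primes are distinct because a common one would divide [h < p]. Both are odd, so [m] and
    [m'] have the opposite parities of [n] and [n + h]. The last equation is [(n - m) * totient m *
    m' = (n + h - m') * totient m' * m], freed of subtraction. *)
Lemma totient_shift_structure (n h p : nat) : prime p -> 0 < n -> odd h ->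
  h < p -> max_pdiv (totient n) = p -> totient n = totient (n + h) ->
  [\/ exists2 d, p <= d & d ^ 2 %| n, exists2 d, p <= d & d ^ 2 %| n + h |
      exists k k' m m',
      [/\ 0 < k, 0 < k', max_pdiv k <= p & max_pdiv k' <= p] /\
      [/\ n = (p * k + 1) * m, n + h = (p * k' + 1) * m',
          coprime (p * k + 1) (p * k' + 1), odd m != odd m' &
          n * (totient m * m') + m' * (totient m' * m) =
          (n + h) * (totient m' * m) + m * (totient m * m')]].
Proof.
move=> p_pr n0 h_odd hp Ep Et.
have p1 := prime_gt1 p_pr.
have t0 : 0 < totient n by rewrite totient_gt0.
have p_dvd : p %| totient n by rewrite -Ep max_pdiv_dvd.
have nh0 : 0 < n + h by rewrite addn_gt0 n0.
have p_dvd' : p %| totient (n + h) by rewrite -Et.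
have [|[k [m [En q_pr k0 Etn]]]] := totient_large_prime_cofactor p_pr n0 p_dvd.
  by move=> H; apply: Or31.
have [|[k' [m' [En' q'_pr k'0 Etn']]]] :=
  totient_large_prime_cofactor p_pr nh0 p_dvd'.
  by move=> H; apply: Or32.
apply: Or33; exists k, k', m, m'.
have q_odd l : 0 < l -> prime (p * l + 1) -> odd (p * l + 1).
  by move=> l0 /even_prime[|//]; nia.
split; split=> //.
- by rewrite -Ep max_pdiv_dvdn // Etn; apply/dvdnP; exists (p * totient m); ring.
- by rewrite -Ep max_pdiv_dvdn // Et Etn'; apply/dvdnP; exists (p * totient m'); ring.
- rewrite prime_coprime //; apply/negP; rewrite dvdn_prime2 // => /eqP Eq.
  have : p * k + 1 %| h.
    rewrite -(dvdn_addr h (m := n)); first by rewrite En' Eq dvdn_mulr.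
    by rewrite En dvdn_mulr.
  by move/dvdn_leq => /(_ (odd_gt0 h_odd)); nia.
- have := congr1 odd En'; have := congr1 odd En.
  rewrite oddD !oddM h_odd (q_odd k) ?(q_odd k') //= => -> <-.
  by case: (odd m).
- have E : p * k * totient m = p * k' * totient m' by rewrite -Etn -Etn'.
  rewrite En' En.
  transitivity (p * k * totient m * (m * m') + totient m * m * m' +
    totient m' * m * m'); first by ring.
  by rewrite E; ring.
Qed.

Lemma count_orb_leq (A B : pred nat) (a b : nat) :
  \sum_(a <= n < b | A n || B n) 1 <=
  \sum_(a <= n < b | A n) 1 + \sum_(a <= n < b | B n) 1.
Proof.
rewrite big_mkcond [X in _ <= X + _]big_mkcond [X in _ <= _ + X]big_mkcond.
rewrite -big_split /=.
by apply: leq_sum => n _; case: (A n); case: (B n).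
Qed.

Lemma count_has_leq (I : eqType) (r : seq I) (Q : pred I) (E : I -> pred nat)
    (a b : nat) :
  \sum_(a <= n < b | has (fun i => Q i && E i n) r) 1 <=
  \sum_(i <- r | Q i) \sum_(a <= n < b | E i n) 1.
Proof.
elim: r => [|i r IH]; first by rewrite big_nil big_pred0_eq.
rewrite big_cons; apply: leq_trans (count_orb_leq _ _ _ _) _.
case: (Q i) => /=; first by rewrite leq_add2l.
by rewrite big_pred0_eq.
Qed.

Lemma leq_sum_nat_sub (P Q : pred nat) (F G : nat -> nat) (a b : nat) :
  (forall i, a <= i < b -> P i -> Q i && (F i <= G i)) ->
  \sum_(a <= i < b | P i) F i <= \sum_(a <= i < b | Q i) G i.
Proof.
move=> FG; rewrite [leqLHS]big_mkcond [leqRHS]big_mkcond big_seq [leqRHS]big_seq.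
apply: leq_sum => i; rewrite mem_index_iota => iab.
by case: ifP => // /(FG i iab)/andP[-> ->].
Qed.

(* [T p], [Z] and [U] stand for [2xy/p^2], [1 + (2xy)^(1/2)] and [x/y]; the last
   hypothesis is the dichotomy on the size of [(p * k + 1) * (p * k' + 1)]. *)
Lemma count_totient_shift (X Y Z U h : nat) (T : nat -> nat) :
  0 < Y -> odd h -> h <= Y ->
  (forall p k k' m m', Y < p -> 0 < k -> 0 < k' -> 0 < m -> 0 < m' ->
     (p * k + 1) * m <= X -> (p * k' + 1) * m' <= X + h ->
     (p < Z) && (k * k' <= T p) || (m * m' <= U)) ->
  \sum_(1 <= n < X.+1 |
      (totient n == totient (n + h)) && (Y < max_pdiv (totient n))) 1 <=
  \sum_(Y.+1 <= d < (X + h).+1) X %/ d ^ 2 +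
  \sum_(Y.+1 <= d < (X + h).+1) (X + h) %/ d ^ 2 +
  \sum_(1 <= m < U.+1) U %/ m +
  \sum_(1 <= p < Z | prime p && (Y < p))
    \sum_(1 <= k < (T p).+1 | max_pdiv k <= p)
      \sum_(1 <= k' < (T p).+1 | (max_pdiv k' <= p) && (k * k' <= T p))
        (X %/ ((p * k + 1) * (p * k' + 1))).+1.
Proof.
move=> Y0 h_odd hY split_size.
(* Events covering the counted [n]: in [sq l], a large square divides [n + l]; in [cof], cofactors
   with product at most [U] satisfy the linear equation; in [big], primes [p * k + 1] and
   [p * k' + 1] with [k * k' <= T p] divide [n] and [n + h], only their coprimality being
   recorded. *)
pose sq l (n : nat) := has (fun d => predT d && (d ^ 2 %| n + l))
  (index_iota Y.+1 (X + h).+1).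
pose lin m m' n := n * (totient m * m') + m' * (totient m' * m) ==
  (n + h) * (totient m' * m) + m * (totient m * m').
pose cof n := has (fun m => predT m &&
  has (fun m' => (odd m != odd m') && (m * m' <= U) && lin m m' n)
    (index_iota 1 U.+1)) (index_iota 1 U.+1).
pose crt p k k' n := (p * k + 1 %| n) && (p * k' + 1 %| n + h).
pose big n := has (fun p => prime p && (Y < p) &&
  has (fun k => (max_pdiv k <= p) &&
    has (fun k' => (max_pdiv k' <= p) && (k * k' <= T p) &&
        coprime (p * k + 1) (p * k' + 1) && crt p k k' n)
      (index_iota 1 (T p).+1)) (index_iota 1 (T p).+1)) (index_iota 1 Z).
apply: (@leq_trans (\sum_(1 <= n < X.+1 | sq 0 n || sq h n || cof n || big n) 1)).
  apply: leq_sum_nat_sub => n /andP[n0 nX] /andP[/eqP Et Yp]; rewrite leqnn andbT.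
  have p_pr : prime (max_pdiv (totient n)).
    (* [max_pdiv] takes the value 1 at 0 and at 1, which is not above [Y >= 1]. *)
    apply: max_pdiv_prime; case: (totient n) Yp => [|[|//]] //.
    - by rewrite (_ : max_pdiv 0 = 1) // ltnS leqNgt Y0.
    - by rewrite (_ : max_pdiv 1 = 1) // ltnS leqNgt Y0.
  have sqP l d : l <= h -> max_pdiv (totient n) <= d -> d ^ 2 %| n + l -> sq l n.
    move=> lh pd dn; apply/hasP; exists d => //; rewrite mem_index_iota.
    rewrite (leq_trans Yp pd) ltnS; have := dvdn_leq _ dn.
    by rewrite addn_gt0 n0 => /(_ isT); nia.
  case: (totient_shift_structure p_pr n0 h_odd (leq_ltn_trans hY Yp) erefl Et).
  - by case=> d pd dn; rewrite (sqP 0 d) ?addn0.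
  - by case=> d pd dn; rewrite (sqP h d) ?orbT.
  move=> [k [k' [m [m' [[k0 k'0 smk smk'] [En En' cop par E]]]]]].
  have m0 : 0 < m by move: n0; rewrite En muln_gt0 => /andP[].
  have m'0 : 0 < m'.
    by have : 0 < n + h by [rewrite addn_gt0 n0]; rewrite En' muln_gt0 => /andP[].
  have := split_size _ k k' m m' Yp k0 k'0 m0 m'0.
  rewrite -En -En' leq_add2r -ltnS nX => /(_ isT isT) /orP[/andP[pZ kT]|mU].
    apply/orP; right; apply/hasP; exists (max_pdiv (totient n)).
      by rewrite mem_index_iota pZ prime_gt0.
    rewrite p_pr Yp; apply/hasP; exists k.
      rewrite mem_index_iota k0 ltnS; exact: leq_trans (leq_pmulr _ k'0) kT.
    rewrite smk; apply/hasP; exists k'.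
      rewrite mem_index_iota k'0 ltnS; exact: leq_trans (leq_pmull _ k0) kT.
    rewrite smk' kT cop /=; apply/andP; split.
      by rewrite [X in _ %| X]En dvdn_mulr.
    by rewrite [X in _ %| X]En' dvdn_mulr.
  apply/orP; left; apply/orP; right; apply/hasP; exists m.
    rewrite mem_index_iota m0 ltnS; exact: leq_trans (leq_pmulr _ m'0) mU.
  apply/hasP; exists m'.
    rewrite mem_index_iota m'0 ltnS; exact: leq_trans (leq_pmull _ m0) mU.
  by rewrite par mU /lin E eqxx.
have sq_le l : \sum_(1 <= n < X.+1 | sq l n) 1 <=
    \sum_(Y.+1 <= d < (X + h).+1) (X + l) %/ d ^ 2.
  apply: leq_trans (count_has_leq _ _ _ _ _) _.
  apply: leq_sum_nat_sub => d /andP[Yd _] _ /=.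
  by apply: count_dvd_leq; rewrite expn_gt0; lia.
apply: leq_trans (count_orb_leq _ _ _ _) _; apply: leq_add; last first.
  apply: leq_trans (count_has_leq _ _ _ _ _) _; apply: leq_sum => p _.
  apply: leq_trans (count_has_leq _ _ _ _ _) _; apply: leq_sum => k _.
  apply: leq_trans (count_has_leq _ _ _ _ _) _.
  apply: leq_sum_nat_sub => k' _ /andP[-> cop] /=.
  by apply: count_crt_leq => //; rewrite addn1.
apply: leq_trans (count_orb_leq _ _ _ _) _; apply: leq_add; last first.
  apply: leq_trans (count_has_leq _ _ _ _ _) _.
  apply: leq_sum_nat_sub => m /andP[m0 _] _ /=.
  apply: leq_trans (count_has_leq _ _ _ _ _) _.
  apply: (@leq_trans (\sum_(1 <= m' < U.+1 | m * m' <= U) 1)).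
    apply: leq_sum_nat_sub => m' /andP[m'0 _] /andP[par ->] /=.
    (* Equal coefficients of [n] would give [m] and [m'] the same prime factors, in particular the
       same parity. *)
    rewrite /lin; under eq_bigl => n do rewrite mulnDl -addnA.
    apply: count_linear_leq1; apply: contraNN par => /eqP E.
    have := totient_ratio_primes m0 m'0 E (isT : prime 2).
    by rewrite !dvdn2 => /negb_inj->.
  apply: (count_inj_leq (f := predn)) => [i /andP[i0 _]|i j]; last by lia.
  by rewrite prednK // leq_divRL // mulnC.
apply: leq_trans (count_orb_leq _ _ _ _) _; apply: leq_add => //.
by have := sq_le 0; rewrite addn0.
Qed.

(** Send [(k, k')] to [(k, m)] with [m = k * k']: this is injective, [m] is again smooth, and each
    [m] is met at most once per divisor [k]. *)
Lemma count_smooth_pairs_leq (p T : nat) : 0 < p ->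
  \sum_(1 <= k < T.+1 | max_pdiv k <= p)
    \sum_(1 <= k' < T.+1 | (max_pdiv k' <= p) && (k * k' <= T)) 1 <=
  \sum_(1 <= m < T.+1 | max_pdiv m <= p) tau m.
Proof.
move=> p0; apply: (@leq_trans (\sum_(1 <= k < T.+1)
    \sum_(1 <= m < T.+1 | max_pdiv m <= p) (k %| m))).
  apply: leq_sum_nat_sub => k /andP[k0 _] smk /=.
  rewrite [leqRHS]big_mkcond /=.
  apply: (@leq_trans (\sum_(1 <= m < T.+1 | (k %| m) && (max_pdiv m <= p)) 1)).
    apply: (count_inj_sub (f := fun k' => k * k')) => [k' /andP[k'0 _]|i j].
      move=> /andP[smk' kT]; rewrite ltnS kT muln_gt0 k0 k'0 dvdn_mulr //=.
      apply: leq_max_pdiv => // r r_pr; rewrite Euclid_dvdM // => /orP[] rk.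
        by apply: leq_trans smk; apply: dvdn_max_pdiv.
      by apply: leq_trans smk'; apply: dvdn_max_pdiv.
    by move=> _ _ _ _ /eqP; rewrite eqn_pmul2l // => /eqP.
  rewrite big_mkcond; apply: leq_sum => m _.
  by case: (k %| m); case: (_ <= p).
rewrite exchange_big_nat /=; apply: leq_sum_nat_sub => m /andP[m0 _] -> /=.
rewrite (eq_bigr (fun k => if k %| m then 1 else 0)); last first.
  by move=> k _; case: (k %| m).
rewrite -big_mkcond -big_filter sum1_size; apply: uniq_leq_size.
  exact/filter_uniq/iota_uniq.
by move=> k; rewrite mem_filter -dvdn_divisors // => /andP[].
Qed.

(** * Prime factorizations of smooth numbers and of factorials *)

Lemma smooth_prod_primes (z k : nat) : 0 < k -> max_pdiv k <= z ->
  k = \prod_(0 <= r < z.+1 | prime r) r ^ logn r k.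
Proof.
move=> k0 kz; have := @widen_partn (k + z) predT k (leq_addr z k).
rewrite partnT // => Ek; rewrite {1}Ek.
rewrite (big_cat_nat (n := z.+1)) //= ?ltnS ?leq_addl // mulnC big1_seq ?mul1n.
  rewrite [RHS]big_mkcond /=; apply: eq_bigr => r _.
  by case: ifP => // /negbT r_pr; rewrite lognE (negPf r_pr).
move=> r /andP[_]; rewrite mem_index_iota => /andP[zr _].
have [r_dvd|r_dvd] := boolP (r \in primes k).
  by move: r_dvd kz zr => /max_pdiv_max; lia.
by move: r_dvd; rewrite -logn_gt0 -eqn0Ngt => /eqP->.
Qed.

Lemma max_pdiv_fact_leq (z : nat) : 0 < z -> max_pdiv z`! <= z.
Proof.
move=> z0; apply: leq_max_pdiv => // p p_pr.
elim: z {z0} => [|z IH]; first by rewrite Euclid_dvd1.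
by rewrite factS Euclid_dvdM // => /orP[/dvdn_leq->|/IH/leqW].
Qed.

Lemma fact_leq_exp (z : nat) : z`! <= z ^ z.
Proof.
elim: z => // z IH; rewrite factS expnS leq_mul2l /=; apply: leq_trans IH _.
by case: z => // z; rewrite leq_exp2r.
Qed.

Lemma divn_leq_logn_fact (z r : nat) : prime r -> 0 < z -> z %/ r <= logn r z`!.
Proof. by move=> r_pr z0; rewrite logn_fact // big_ltn // expn1 leq_addr. Qed.

(** The range of [a] is the same for all [k <= N], so that sums over [k] and [a] can be
    exchanged. *)
Lemma logn_leq_count (r k N : nat) : prime r -> k <= N ->
  logn r k <= \sum_(1 <= a < N.+1) (r ^ a %| k).
Proof.
move=> r_pr kN; rewrite logn_count_dvd //.
case: k kN => [|k] kN; first by rewrite big_geq.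
by rewrite [leqRHS](big_cat_nat (n := k.+1)) ?leq_addr // leqW.
Qed.

Local Open Scope ring_scope.

(** * Sums over smooth numbers *)

Lemma ler_sum_subseq_uniq (R : numDomainType) (I : eqType) (s t : seq I) (F : I -> R) :
  uniq s -> uniq t -> {subset s <= t} -> (forall i, i \in t -> 0 <= F i) ->
  \sum_(i <- s) F i <= \sum_(i <- t) F i.
Proof.
move=> us ut st F0.
rewrite (perm_big [seq i <- t | i \in s]) /=; last first.
  apply: uniq_perm; rewrite ?filter_uniq // => i; rewrite mem_filter.
  by case: (boolP (i \in s)) => // /st->.
rewrite big_filter big_mkcond big_seq [leRHS]big_seq; apply: ler_sum => i it.
by case: ifP => // _; apply: F0.
Qed.

Lemma ler_sum_inj (R : numDomainType) (P Q : pred nat) (f : nat -> nat)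
    (F G : nat -> R) (a b a' b' : nat) :
  (forall i, (a <= i < b)%N -> P i ->
     [&& (a' <= f i < b')%N, Q (f i) & F i <= G (f i)]) ->
  (forall i j, (a <= i < b)%N -> (a <= j < b)%N -> P i -> P j -> f i = f j -> i = j) ->
  (forall i, (a' <= i < b')%N -> Q i -> 0 <= G i) ->
  \sum_(a <= i < b | P i) F i <= \sum_(a' <= i < b' | Q i) G i.
Proof.
move=> fQ f_inj G0; rewrite -!(big_filter (index_iota _ _)).
have sP i : i \in [seq i <- index_iota a b | P i] -> P i /\ (a <= i < b)%N.
  by rewrite mem_filter mem_index_iota => /andP[].
have tP i : i \in [seq i <- index_iota a' b' | Q i] -> Q i /\ (a' <= i < b')%N.
  by rewrite mem_filter mem_index_iota => /andP[].
apply: (@le_trans _ _ (\sum_(i <- [seq i <- index_iota a b | P i]) G (f i))).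
  rewrite big_seq [leRHS]big_seq; apply: ler_sum => i /sP[Pi iab].
  by case/and3P: (fQ i iab Pi).
rewrite -(big_map f predT G); apply: ler_sum_subseq_uniq.
- rewrite map_inj_in_uniq; first exact/filter_uniq/iota_uniq.
  by move=> i j /sP[Pi Hi] /sP[Pj Hj]; apply: f_inj.
- exact/filter_uniq/iota_uniq.
- move=> _ /mapP[i /sP[Pi iab] ->]; rewrite mem_filter mem_index_iota.
  by case/and3P: (fQ i iab Pi) => -> ->.
- by move=> i /tP[Qi iab]; apply: G0.
Qed.

Lemma ler_sum_nat_cond (R : numDomainType) (P : pred nat) (F G : nat -> R) (a b : nat) :
  (forall i, (a <= i < b)%N -> P i -> F i <= G i) ->
  \sum_(a <= i < b | P i) F i <= \sum_(a <= i < b | P i) G i.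
Proof.
move=> FG; rewrite big_seq_cond [leRHS]big_seq_cond.
by apply: ler_sum => i; rewrite mem_index_iota => /andP[/FG].
Qed.

Lemma ln_prod (R : realType) (I : Type) (s : seq I) (P : pred I) (F : I -> R) :
  (forall i, P i -> 0 < F i) ->
  ln (\prod_(i <- s | P i) F i) = \sum_(i <- s | P i) ln (F i).
Proof.
move=> F0; suff [] : 0 < \prod_(i <- s | P i) F i /\
  ln (\prod_(i <- s | P i) F i) = \sum_(i <- s | P i) ln (F i) by [].
elim/big_ind2 : _ => [|x1 y1 x2 y2 [x10 <-] [x20 <-]|i /F0 ?] //.
  by rewrite ltr01 ln1.
by rewrite mulr_gt0 // lnM.
Qed.

Lemma ln_smooth (R : realType) (z k : nat) : (0 < k)%N -> (max_pdiv k <= z)%N ->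
  ln (k%:R : R) = \sum_(0 <= r < z.+1 | prime r) (logn r k)%:R * ln r%:R.
Proof.
move=> k0 kz; rewrite {1}(smooth_prod_primes k0 kz) natr_prod ln_prod.
  apply: eq_bigr => r r_pr.
  by rewrite natrX lnXn ?ltr0n ?prime_gt0 // mulr_natl.
by move=> r r_pr; rewrite ltr0n expn_gt0 prime_gt0.
Qed.

Lemma harmonic_ub (R : realType) (n : nat) : (0 < n)%N ->
  \sum_(1 <= k < n.+1) (k%:R : R)^-1 <= 1 + ln n%:R.
Proof.
elim: n => // -[_ _|n IH _]; first by rewrite big_nat1 invr1 ln1 addr0.
rewrite big_nat_recr //= (le_trans (lerD (IH isT) (lexx _))) // -addrA lerD2l.
have n1 : (0 : R) < n.+1%:R by rewrite ltr0n.
have n2 : (0 : R) < n.+2%:R by rewrite ltr0n.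
have iv : (n.+2%:R : R)^-1 < 1 by rewrite invf_lt1 // ltr1n.
(* Each new term is at most an increment of [ln], by [ln (1 - 1/(n+2)) <= - 1/(n+2)]. *)
have := @le_ln1Dx R (- n.+2%:R^-1) ltac:(by rewrite ltrN2).
have -> : (1 : R) - n.+2%:R^-1 = n.+1%:R / n.+2%:R.
  have E : (n.+2%:R : R) = n.+1%:R + 1 by rewrite natr1.
  by rewrite -[X in X - _](mulfV (lt0r_neq0 n2)) -[X in _ - X]mul1r -mulrBl E addrK.
by rewrite ln_div ?posrE //; move: (ln n.+1%:R) (ln n.+2%:R) (_^-1) => a b c; lra.
Qed.

(* Compare [ln z`!] with its prime factorization, where [logn r z`! >= z / (2 r)]. *)
Lemma sum_ln_div_primes_ub (R : realType) (z : nat) : (0 < z)%N ->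
  \sum_(0 <= r < z.+1 | prime r) (ln r%:R / r%:R : R) <= 2 * ln z%:R.
Proof.
move=> z0; have zR : (0 : R) < z%:R by rewrite ltr0n.
rewrite -(ler_pM2l zR) mulr_sumr.
apply: (@le_trans _ _ (2 * ln (z`!%:R : R))); last first.
  rewrite mulrCA ler_pM2l // mulr_natl -lnXn // ler_ln ?posrE ?exprn_gt0 //.
    by rewrite -natrX ler_nat fact_leq_exp.
  by rewrite ltr0n fact_gt0.
rewrite (ln_smooth R (fact_gt0 z) (max_pdiv_fact_leq z0)) mulr_sumr.
apply: ler_sum_nat_cond => r /andP[_ rz] r_pr.
have r0 : (0 : R) < r%:R by rewrite ltr0n prime_gt0.
rewrite mulrCA [leLHS]mulrC mulrA ler_wpM2r ?ln_ge0 ?ler1n ?prime_gt0 //.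
rewrite ler_pdivrMr // -!natrM ler_nat.
(* As [r <= z], the quotient is at least 1, whence [z < r * (z %/ r + 1) <= 2 * r * (z %/ r)]. *)
have := divn_leq_logn_fact r_pr z0.
have : (0 < z %/ r)%N by rewrite divn_gt0 ?prime_gt0.
by have := ltn_ceil z (prime_gt0 r_pr); nia.
Qed.

(** Adding a term turns the sum [S] into [(1 + S) / r], and [S <= 2 / r <= 1] is preserved. *)
Lemma geometric_tail_ub (R : realType) (r N : nat) : (1 < r)%N ->
  \sum_(1 <= a < N.+1) ((r ^ a)%:R : R)^-1 <= 2 / r%:R.
Proof.
move=> r1; have r2 : (2 : R) <= r%:R by rewrite ler_nat.
have r0 : (0 : R) < r%:R by apply: lt_le_trans r2.
have v0 : 0 < (r%:R : R)^-1 by rewrite invr_gt0.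
have v2 : (r%:R : R)^-1 <= 2^-1 by rewrite lef_pV2 ?posrE.
elim: N => [|N IH]; first by rewrite big_geq // mulr_ge0 // ltW.
rewrite big_nat_recl // expn1.
under eq_bigr => a _ do rewrite expnS natrM invfM.
rewrite -mulr_sumr mulrC; move: IH; set S := \sum_(_ <= _ < _) _ => IH.
have : S * r%:R^-1 <= (2 / r%:R) * r%:R^-1 by rewrite ler_pM2r.
by have : (2 / r%:R) * r%:R^-1 <= 1 * (r%:R : R)^-1; [rewrite ler_pM2r //; lra|lra].
Qed.

(** The cutoff [N] keeps the sum finite; the final bound [smooth_harmonic_ub] is uniform in [N]. *)
Definition smooth_harmonic (R : realType) (z N : nat) : R :=
  \sum_(1 <= k < N.+1 | (max_pdiv k <= z)%N) k%:R^-1.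

Lemma smooth_harmonic_ge0 (R : realType) (z N : nat) : 0 <= smooth_harmonic R z N.
Proof. by apply: sumr_ge0 => k _; rewrite invr_ge0. Qed.

Lemma smooth_harmonic_multiples (R : realType) (z N D : nat) : (0 < D)%N ->
  \sum_(1 <= k < N.+1 | (max_pdiv k <= z)%N && (D %| k)%N) (k%:R : R)^-1 <=
  D%:R^-1 * smooth_harmonic R z N.
Proof.
move=> D0; rewrite /smooth_harmonic mulr_sumr.
apply: (ler_sum_inj (f := fun k => (k %/ D)%N)).
- move=> k /andP[k0 kN] /andP[smk /dvdnP[j Ej]].
  have j0 : (0 < j)%N by move: k0; rewrite Ej muln_gt0 => /andP[].
  rewrite Ej mulnK // j0 -invfM -natrM mulnC lexx andbT /=; apply/andP; split.
    by apply: leq_ltn_trans kN; rewrite Ej leq_pmulr.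
  apply: leq_trans smk; apply: max_pdiv_dvdn => //.
  by rewrite Ej dvdn_mulr.
- move=> i j _ _ /andP[_ iD] /andP[_ jD] E.
  by rewrite -(divnK iD) -(divnK jD) E.
- by move=> i _ _; rewrite mulr_ge0 ?invr_ge0.
Qed.

(** Expand [ln k] as the sum of [ln r] over prime powers [r ^ a] dividing [k]. The multiples of
    [r ^ a] carry at most [S / r ^ a], summing over [a] gives [2 * S / r], and the sum of [ln r / r]
    over primes is at most [2 * ln z]. *)
Lemma smooth_ln_sum_ub (R : realType) (z N : nat) : (0 < z)%N ->
  \sum_(1 <= k < N.+1 | (max_pdiv k <= z)%N) (ln k%:R / k%:R : R) <=
  4 * ln z%:R * smooth_harmonic R z N.
Proof.
move=> z0; set S := smooth_harmonic R z N.
have S0 : 0 <= S := smooth_harmonic_ge0 R z N.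
have lnr0 r : prime r -> 0 <= ln (r%:R : R).
  by move=> r_pr; rewrite ln_ge0 // ler1n prime_gt0.
apply: (@le_trans _ _ (\sum_(1 <= k < N.+1 | (max_pdiv k <= z)%N)
   \sum_(0 <= r < z.+1 | prime r)
     \sum_(1 <= a < N.+1) ln r%:R * ((r ^ a %| k)%N%:R / k%:R))).
  apply: ler_sum_nat_cond => k /andP[k0 kN] smk.
  rewrite (ln_smooth R k0 smk) mulr_suml; apply: ler_sum => r r_pr.
  rewrite -mulr_sumr -mulr_suml mulrCA -mulrA ler_wpM2r //.
    by rewrite mulr_ge0 ?lnr0 ?invr_ge0.
  rewrite -natr_sum ler_nat.
  exact: logn_leq_count.
rewrite exchange_big_nat /=.
apply: (@le_trans _ _ (\sum_(0 <= r < z.+1 | prime r) 2 * S * (ln r%:R / r%:R))).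
  apply: ler_sum => r r_pr; rewrite exchange_big_nat /=.
  apply: (@le_trans _ _ (\sum_(1 <= a < N.+1) ln r%:R * S * (r ^ a)%:R^-1)).
    apply: ler_sum => a _; rewrite -mulr_sumr -mulrA ler_wpM2l ?lnr0 //.
    rewrite mulrC; apply: le_trans (smooth_harmonic_multiples R z N _); last first.
      by rewrite expn_gt0 prime_gt0.
    rewrite big_mkcondr /=; apply: ler_sum => k _.
    by case: (_ %| k)%N; rewrite ?mul1r ?mul0r.
  rewrite -mulr_sumr.
  have := geometric_tail_ub R N (prime_gt1 r_pr).
  move=> /(ler_wpM2l (mulr_ge0 (lnr0 r r_pr) S0)) /le_trans; apply.
  by rewrite le_eqVlt; apply/orP; left; apply/eqP; ring.
rewrite -mulr_sumr.
have := ler_wpM2l (mulr_ge0 (ler0n R 2) S0) (sum_ln_div_primes_ub R z0).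
by move/le_trans; apply; rewrite le_eqVlt; apply/orP; left; apply/eqP; ring.
Qed.

(* Markov's inequality: by [smooth_ln_sum_ub], the terms [k > z ^ 8] carry at
   most half of the sum. *)
Lemma smooth_harmonic_ub (R : realType) (z N : nat) : (1 < z)%N ->
  smooth_harmonic R z N <= 2 + 16 * ln z%:R.
Proof.
move=> z1; have z0 : (0 < z)%N by lia.
have lnz : 0 < ln (z%:R : R) by rewrite ln_gt0 // ltr1n.
have Z0 : (0 < z ^ 8)%N by rewrite expn_gt0 z0.
have H := harmonic_ub R Z0; rewrite natrX lnXn ?ltr0n // -[ln _ *+ 8]mulr_natl in H.
have L := smooth_ln_sum_ub R N z0; move: L; set S := smooth_harmonic R z N => L.
(* The 8 is twice the 4 of [smooth_ln_sum_ub]: for [k > z ^ 8] the weight [ln k / (8 * ln z)] is at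
   least 1, so the tail is at most [S / 2] and [S <= 2 * (1 + 8 * ln z)]. *)
suff : S <= \sum_(1 <= k < (z ^ 8).+1) (k%:R : R)^-1 +
    (8 * ln z%:R)^-1 * \sum_(1 <= k < N.+1 | (max_pdiv k <= z)%N) (ln k%:R / k%:R).
  have e8 : 0 < (8 * ln (z%:R : R))^-1 by rewrite invr_gt0 mulr_gt0.
  move: L; rewrite -(ler_pM2l e8) => L.
  have E : (8 * ln z%:R)^-1 * (4 * ln z%:R * S) = S / 2.
    by field; rewrite gt_eqF.
  by rewrite E in L; lra.
rewrite mulr_sumr.
apply: (@le_trans _ _ (\sum_(1 <= k < N.+1 | (max_pdiv k <= z)%N && (k <= z ^ 8)%N)
    (k%:R : R)^-1 + \sum_(1 <= k < N.+1 | (max_pdiv k <= z)%N)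
    (8 * ln z%:R)^-1 * (ln k%:R / k%:R))).
  rewrite big_mkcondr -big_split /=; apply: ler_sum_nat_cond => k /andP[k0 _] _.
  have kR : (0 : R) < k%:R by rewrite ltr0n.
  have lk0 : 0 <= ln (k%:R : R) by rewrite ln_ge0 // ler1n.
  case: leqP => [_|kz].
    by rewrite lerDl !mulr_ge0 ?invr_ge0 // ?mulr_ge0 // ltW.
  rewrite add0r mulrA ler_peMl ?invr_ge0 //.
  rewrite mulrC ler_pdivlMr ?mulr_gt0 // mul1r mulr_natl -lnXn ?ltr0n //.
  by rewrite ler_ln ?posrE ?exprn_gt0 ?ltr0n // -natrX ler_nat ltnW.
rewrite lerD2r; apply: (ler_sum_inj (f := id)) => [k /andP[k0 _] /andP[_ kz]|//|k _ _].
  by rewrite k0 ltnS kz lexx.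
by rewrite invr_ge0.
Qed.

(** * Assembling the bound *)

(** A telescoping step: for [L = ln t + 4], the function [L ^ 2 / t] has derivative
    [- (L ^ 2 - 2 * L) / t ^ 2], at most [- L ^ 2 / (2 * t ^ 2)] when [L >= 4]. The factor 4 leaves
    room for the discrete version. *)
Lemma sum_sqr_ln_step (R : realType) (n : nat) : (0 < n)%N ->
  (ln (n.+1%:R : R) + 4) ^+ 2 / n.+1%:R ^+ 2 <=
  4 * ((ln n%:R + 4) ^+ 2 / n%:R - (ln n.+1%:R + 4) ^+ 2 / n.+1%:R).
Proof.
move=> n0; have a1 : (1 : R) <= n%:R by rewrite ler1n.
have a0 : (0 : R) < n%:R by rewrite ltr0n.
have := @le_ln1Dx R n%:R^-1 (lt_trans (ltrN10 R) _).
rewrite invr_gt0 a0 => /(_ isT).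
have -> : 1 + (n%:R : R)^-1 = n.+1%:R / n%:R.
  by rewrite -(natr1 n) mulrDl mul1r divff // gt_eqF.
rewrite ln_div ?posrE ?ltr0n //.
have : ln (n%:R : R) <= ln n.+1%:R by rewrite ler_ln ?posrE ?ltr0n // ler_nat.
have : 0 <= ln (n%:R : R) by rewrite ln_ge0.
rewrite -(natr1 n); move: a1 a0; move: (ln n%:R) (ln (n%:R + 1)) => l l'.
move: (n%:R : R) => a a1 a0 l0 ll' e1.
have b0 : 0 < a + 1 by lra.
have ae : a * (l' - l) <= 1 by rewrite mulrC -ler_pdivlMr // div1r.
rewrite -subr_ge0.
set u := l + 4; set e := l' - l; have -> : l' + 4 = u + e by rewrite /u /e; ring.
have -> : 4 * (u ^+ 2 / a - (u + e) ^+ 2 / (a + 1)) - (u + e) ^+ 2 / (a + 1) ^+ 2 =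
  (4 * (a + 1) * (u ^+ 2 * (a + 1) - (u + e) ^+ 2 * a) - a * (u + e) ^+ 2) /
  (a * (a + 1) ^+ 2) by field; rewrite !gt_eqF.
rewrite divr_ge0 ?mulr_ge0 ?exprn_ge0 ?(ltW a0) ?(ltW b0) // subr_ge0.
have u4 : 4 <= u by rewrite /u; lra.
have e0 : 0 <= e by rewrite /e; lra.
have ae1 : a * e <= 1 by [].
have e11 : e <= 1 by nra.
(* By [a * e <= 1] and [e <= 1] this reduces to [(u + 1) ^ 2 <= 4 * (u ^ 2 - 2 * u - 1)], true for
   [u >= 4]; hence the shift by 4. *)
have K : (u + e) ^+ 2 <= 4 * (u ^+ 2 * (a + 1) - (u + e) ^+ 2 * a).
  have -> : u ^+ 2 * (a + 1) - (u + e) ^+ 2 * a =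
    u ^+ 2 - 2 * u * (a * e) - (a * e) * e by ring.
  have : u * (a * e) <= u * 1 by rewrite ler_wpM2l //; lra.
  have : (a * e) * e <= 1 by have := ler_pM (mulr_ge0 (ltW a0) e0) e0 ae1 e11; lra.
  have : (u + e) ^+ 2 <= (u + 1) ^+ 2 by rewrite lerXn2r ?nnegrE //; lra.
  rewrite !expr2; nra.
rewrite (mulrC 4) -(mulrA (a + 1)).
apply: (@le_trans _ _ ((a + 1) * (u + e) ^+ 2)).
  by rewrite ler_wpM2r ?sqr_ge0 //; lra.
by rewrite ler_wpM2l // ltW.
Qed.

Lemma sum_sqr_ln_tail (R : realType) (Y D : nat) : (0 < Y)%N ->
  \sum_(Y.+1 <= d < D) ((ln (d%:R : R) + 4) ^+ 2 / d%:R ^+ 2) <=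
  4 * ((ln Y%:R + 4) ^+ 2 / Y%:R).
Proof.
move=> Y0; have [DY|YD] := leqP D Y.+1.
  by rewrite big_geq // mulr_ge0 // divr_ge0 // sqr_ge0.
pose G n := (ln (n%:R : R) + 4) ^+ 2 / n%:R.
have -> : D = (Y + (D.-1 - Y)).+1 by lia.
move: (D.-1 - Y)%N => l.
suff : \sum_(Y.+1 <= d < (Y + l).+1) ((ln (d%:R : R) + 4) ^+ 2 / d%:R ^+ 2) <=
    4 * (G Y - G (Y + l)%N).
  have : 0 <= G (Y + l)%N by rewrite divr_ge0 // sqr_ge0.
  by rewrite -/(G Y); lra.
elim: l => [|l IH]; first by rewrite addn0 big_geq // subrr mulr0.
rewrite addnS big_nat_recr /=; last by rewrite ltnS leq_addr.
have := @sum_sqr_ln_step R (Y + l) ltac:(by rewrite addn_gt0 Y0).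
by move=> /(lerD IH)/le_trans; apply; rewrite -mulrDr addrA subrK.
Qed.

Lemma natr_divn_le (R : realFieldType) (a b : nat) :
  (a %/ b)%N%:R <= a%:R / b%:R :> R.
Proof.
case: b => [|b]; first by rewrite divn0 invr0 mulr0.
by rewrite ler_pdivlMr ?ltr0n // -natrM ler_nat leq_divM.
Qed.

(** The terms 1 count smooth pairs. The quotients are at most [X / (p ^ 2 * k * k')]; dropping
    [k * k' <= T] leaves the square of a smooth harmonic sum, which is at most [16 * (ln p + 4)],
    and [256 = 16 ^ 2]. *)
Lemma crt_pairs_ub (R : realType) (X T p : nat) : (1 < p)%N ->
  (\sum_(1 <= k < T.+1 | max_pdiv k <= p)
     \sum_(1 <= k' < T.+1 | (max_pdiv k' <= p) && (k * k' <= T))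
       (X %/ ((p * k + 1) * (p * k' + 1))).+1)%N%:R <=
  256 * X%:R * ((ln p%:R + 4) ^+ 2 / p%:R ^+ 2) +
  (\sum_(1 <= m < T.+1 | max_pdiv m <= p) tau m)%N%:R :> R.
Proof.
move=> p1; have p0 : (0 < p)%N by lia.
have pR : (0 : R) < p%:R by rewrite ltr0n.
under eq_bigr => k _ do under eq_bigr => k' _ do rewrite -addn1.
under eq_bigr => k _ do rewrite big_split.
rewrite big_split natrD lerD //; last by rewrite ler_nat count_smooth_pairs_leq.
apply: (@le_trans _ _ (X%:R / p%:R ^+ 2 *
    (smooth_harmonic R p T * smooth_harmonic R p T))); last first.
  have S0 := smooth_harmonic_ge0 R p T; have S1 := smooth_harmonic_ub R T p1.
  have lp : 0 <= ln (p%:R : R) by rewrite ln_ge0 // ler1n.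
  have -> : 256 * X%:R * ((ln p%:R + 4) ^+ 2 / p%:R ^+ 2) =
    X%:R / p%:R ^+ 2 * ((16 * (ln p%:R + 4)) * (16 * (ln p%:R + 4))) :> R by ring.
  rewrite ler_wpM2l ?divr_ge0 ?exprn_ge0 //.
  by apply: ler_pM => //; lra.
rewrite natr_sum /smooth_harmonic mulr_suml mulr_sumr.
apply: ler_sum_nat_cond => k /andP[k0 _] smk.
rewrite natr_sum mulr_sumr mulr_sumr big_mkcondr /=.
apply: ler_sum_nat_cond => k' /andP[k'0 _] smk'.
have kR : (0 : R) < k%:R by rewrite ltr0n.
have k'R : (0 : R) < k'%:R by rewrite ltr0n.
have rhs0 : 0 <= X%:R / p%:R ^+ 2 * (k%:R^-1 * k'%:R^-1) :> R.
  by rewrite mulr_ge0 ?divr_ge0 ?exprn_ge0 ?mulr_ge0 ?invr_ge0.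
case: ifP => // _; apply: le_trans (natr_divn_le _ _ _) _.
rewrite -mulrA ler_wpM2l // -!invfM lef_pV2 ?posrE; last first.
- by rewrite !mulr_gt0 ?exprn_gt0.
- by rewrite ltr0n muln_gt0 !addn1.
rewrite -natrX -!natrM ler_nat; nia.
Qed.

Lemma hyperbola_sum_ub (R : realType) (t : R) : 1 <= t ->
  (\sum_(1 <= m < (Num.truncn t).+1) Num.truncn t %/ m)%N%:R <= t + t * ln t.
Proof.
move=> t1; have t0 : 0 < t by apply: lt_le_trans t1.
have Ut : (Num.truncn t)%:R <= t by rewrite truncn_le ltW.
have U0 : (0 < Num.truncn t)%N by rewrite truncn_gt0.
rewrite natr_sum; apply: (@le_trans _ _
    (\sum_(1 <= m < (Num.truncn t).+1) t * (m%:R : R)^-1)).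
  apply: ler_sum => m _; apply: le_trans (natr_divn_le _ _ _) _.
  by rewrite ler_wpM2r ?invr_ge0.
rewrite -mulr_sumr -[X in X + _]mulr1 -mulrDr ler_wpM2l ?(ltW t0) //.
apply: le_trans (harmonic_ub R U0) _; rewrite lerD2l.
by rewrite ler_ln ?posrE ?ltr0n.
Qed.

(** Put [q = p * k + 1] and [q' = p * k' + 1]. If [q * q' <= 2xy], use [p ^ 2 * k * k' <= q * q'];
    otherwise divide [(q * m) * (q' * m') <= x * 2x] by [q * q']. *)
Lemma totient_shift_size (R : realType) (x y : R) (X h p k k' m m' : nat) :
  0 < y -> 0 < x -> (0 < p)%N -> (0 < k)%N -> (0 < k')%N -> X%:R <= x ->
  h%:R <= x -> ((p * k + 1) * m <= X)%N -> ((p * k' + 1) * m' <= X + h)%N ->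
  (p < (Num.truncn (Num.sqrt (2 * x * y))).+1)%N &&
  (k * k' <= Num.truncn (2 * x * y / p%:R ^+ 2))%N ||
  (m * m' <= Num.truncn (x / y))%N.
Proof.
move=> y0 x0 p0 k0 k'0 Xx hx nX nX'.
have xy0 : 0 < 2 * x * y by rewrite !mulr_gt0.
have pR : (0 : R) < p%:R by rewrite ltr0n.
have mX : ((p * k + 1) * m)%N%:R <= x by apply: le_trans Xx; rewrite ler_nat.
have mX' : ((p * k' + 1) * m')%N%:R <= 2 * x.
  apply: (@le_trans _ _ (X + h)%N%:R); first by rewrite ler_nat.
  by rewrite natrD; lra.
set q := (p * k + 1)%N in nX mX *; set q' := (p * k' + 1)%N in nX' mX' *.
have pq : (p ^ 2 * (k * k') <= q * q')%N by rewrite /q /q'; nia.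
have [small|large] := lerP (q * q')%N%:R (2 * x * y).
  have {}small : (p ^ 2 * (k * k'))%N%:R <= 2 * x * y.
    by apply: le_trans small; rewrite ler_nat.
  apply/orP; left; rewrite ltnS !truncn_ge_nat ?sqrtr_ge0 ?divr_ge0 ?sqr_ge0 ?(ltW xy0) //.
  apply/andP; split; last first.
    by rewrite ler_pdivlMr ?exprn_gt0 // mulrC -natrX -natrM.
  rewrite -[leLHS](ger0_norm (ltW pR)) -sqrtr_sqr ler_wsqrtr //.
  apply: le_trans small; rewrite -natrX ler_nat leq_pmulr //.
  by rewrite muln_gt0 k0.
apply/orP; right; rewrite truncn_ge_nat ?divr_ge0 ?(ltW x0) ?(ltW y0) //.
rewrite ler_pdivlMr // -(ler_pM2r (_ : 0 < 2 * x)) ?mulr_gt0 //.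
rewrite -mulrA [y * _]mulrC.
apply: (@le_trans _ _ ((m * m')%N%:R * (q * q')%N%:R)); first by rewrite ler_wpM2l // ltW.
have -> : (m * m')%N%:R * (q * q')%N%:R = (q * m)%N%:R * (q' * m')%N%:R :> R.
  by rewrite -!natrM; congr (_%:R); ring.
exact: ler_pM.
Qed.

Theorem theorem1p6 (R : realType) :
  exists C : R, 0 < C /\
    forall (x y : R) (h : nat),
      2 <= y -> y <= x -> (0 < h)%N -> odd h -> h%:R <= y ->
      (B h x y)%:R <=
        C * (x / y + Num.sqrt x + x * ln x / y + x * ln y ^+ 2 / y +
             \sum_(1 <= p < (Num.truncn (Num.sqrt (2 * x * y))).+1 |
                     prime p && (y < p%:R))
                (Psi_tau (2 * x * y / p%:R ^+ 2) p%:R)%:R).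
Proof.
(* Here [259 = 1 + 2 + 256] counts the multiples of [x * W] from the squares dividing [n], those
   dividing [n + h], and the pairs of primes; 648 comes from [WB]. *)
exists (259 * 648); split=> [|x y h y2 yx h0 h_odd hy]; first by lra.
have y0 : 0 < y by lra.
have x0 : 0 < x by lra.
have hx : h%:R <= x by apply: le_trans yx.
set X := Num.truncn x; set Y := Num.truncn y; set Z := Num.truncn (Num.sqrt _).
have Xx : X%:R <= x by rewrite truncn_le ltW.
have Yy : Y%:R <= y by rewrite truncn_le ltW.
have Y0 : (0 < Y)%N by rewrite truncn_gt0; lra.
have YR : (1 : R) <= Y%:R by rewrite ler1n.
have yY : y <= 2 * Y%:R by have := truncnS_gt y; rewrite -/Y -natr1; lra.
have hY : (h <= Y)%N by rewrite truncn_ge_nat // ltW.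
have ltY n : (y < n%:R) = (Y < n)%N by rewrite truncn_lt_nat // ltW.
pose T p := Num.truncn (2 * x * y / p%:R ^+ 2).
have split_size p k k' m m' : (Y < p)%N -> (0 < k)%N -> (0 < k')%N ->
    (0 < m)%N -> (0 < m')%N ->
    ((p * k + 1) * m <= X)%N -> ((p * k' + 1) * m' <= X + h)%N ->
    (p < Z.+1)%N && (k * k' <= T p)%N || (m * m' <= Num.truncn (x / y))%N.
  move=> Yp k0 k'0 _ _; apply: totient_shift_size => //.
  exact: leq_ltn_trans Yp.
have := count_totient_shift Y0 h_odd hY split_size.
rewrite -(ler_nat R) !natrD /B => main.
under eq_bigl => n do rewrite ltY.
apply: le_trans main _.
(* Since [w d] dominates [1 / d ^ 2], one tail bound [W] serves both the squares and the pairs of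
   primes. *)
pose w d := (ln (d%:R : R) + 4) ^+ 2 / d%:R ^+ 2.
have w1 d : (0 < d)%N -> (d%:R ^+ 2 : R)^-1 <= w d.
  move=> d0; rewrite -[leLHS]mul1r ler_wpM2r ?invr_ge0 ?exprn_ge0 //.
  have : 0 <= ln (d%:R : R) by rewrite ln_ge0 // ler1n.
  by rewrite expr2; nra.
set W := 4 * ((ln Y%:R + 4) ^+ 2 / Y%:R) : R.
have sqW l c D : (l%:R : R) <= c -> 
    (\sum_(Y.+1 <= d < D) l %/ d ^ 2)%N%:R <= c * W.
  move=> lc; have c0 : 0 <= c by apply: le_trans lc.
  rewrite natr_sum; apply: le_trans (ler_wpM2l c0 (sum_sqr_ln_tail R D Y0)).
  rewrite mulr_sumr; apply: ler_sum_nat_cond => d /andP[Yd _] _.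
  apply: le_trans (natr_divn_le _ _ _) _; rewrite natrX.
  apply: ler_pM => //; rewrite ?invr_ge0 ?exprn_ge0 //.
  by apply: w1; apply: leq_trans Yd.
have S1 := sqW X x (X + h).+1 Xx.
have S2 : (\sum_(Y.+1 <= d < (X + h).+1) (X + h) %/ d ^ 2)%N%:R <= (2 * x) * W.
  by apply: sqW; rewrite natrD; lra.
have xy1 : 1 <= x / y by rewrite ler_pdivlMr // mul1r.
have S3 := hyperbola_sum_ub xy1.
have lnx : ln (x / y) <= ln x.
  by rewrite ler_ln ?posrE ?divr_gt0 // ler_pdivrMr // ler_peMr //; lra.
have {}S3 := le_trans S3 (lerD (lexx _) (ler_wpM2l (ltW (lt_le_trans ltr01 xy1)) lnx)).
set P := \sum_(1 <= p < Z.+1 | prime p && (y < p%:R)) _.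
have S4 : (\sum_(1 <= p < Z.+1 | prime p && (Y < p)%N)
    \sum_(1 <= k < (T p).+1 | (max_pdiv k <= p)%N)
      \sum_(1 <= k' < (T p).+1 | (max_pdiv k' <= p)%N && (k * k' <= T p)%N)
        (X %/ ((p * k + 1) * (p * k' + 1))).+1)%N%:R <= 256 * x * W + P.
  rewrite natr_sum /P; under [X in _ + X]eq_bigl => p do rewrite ltY.
  apply: (@le_trans _ _ (\sum_(1 <= p < Z.+1 | prime p && (Y < p)%N)
    (256 * x * w p + (Psi_tau (2 * x * y / p%:R ^+ 2) p%:R)%:R))).
    apply: ler_sum => p /andP[p_pr Yp].
    apply: le_trans (crt_pairs_ub R X (T p) (prime_gt1 p_pr)) _.
    rewrite lerD //; last first.
      by rewrite ler_nat /Psi_tau; under [leqRHS]eq_bigl => m do rewrite ler_nat.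
    by rewrite ler_wpM2r ?ler_pM2l // divr_ge0 ?sqr_ge0.
  rewrite big_split lerD2r.
  apply: le_trans (ler_wpM2l _ (sum_sqr_ln_tail R Z.+1 Y0)); last by lra.
  (* The sum over primes is extended to all integers above [Y], the terms being nonnegative. *)
  rewrite mulr_sumr; apply: (ler_sum_inj (f := id)) => //.
    by move=> p /andP[_ pZ] /andP[_ Yp]; rewrite Yp pZ lexx.
  by move=> d _ _; rewrite mulr_ge0 ?divr_ge0 ?sqr_ge0 //; lra.
(* This follows from [ln (1/2) <= - 1/2] and yields [ln y + 4 <= 9 * ln y]. *)
have lny : 1 <= 2 * ln y.
  have : ln (2 : R) <= ln y by rewrite ler_ln ?posrE.
  have := @le_ln1Dx R (2^-1 - 1) ltac:(lra).
  by rewrite addrCA subrr addr0 lnV ?posrE //; lra.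
(* [648 = 4 * 9 ^ 2 * 2]: the 4 of [W], the 9 from [lny], and the 2 from [1 / Y <= 2 / y]. *)
have WB : x * W <= 648 * (x * ln y ^+ 2 / y).
  have lY0 : 0 <= ln (Y%:R : R) by rewrite ln_ge0.
  have lYy : ln (Y%:R : R) <= ln y by rewrite ler_ln ?posrE ?ltr0n.
  have -> : 648 * (x * ln y ^+ 2 / y) = x * (4 * ((9 * ln y) ^+ 2 * (2 / y))).
    by rewrite exprMn; ring.
  rewrite ler_wpM2l ?(ltW x0) // ler_wpM2l //.
  apply: ler_pM; rewrite ?sqr_ge0 ?invr_ge0 //.
    by rewrite lerXn2r ?nnegrE //; lra.
  by rewrite -[leLHS]mul1r ler_pdivrMr ?ltr0n // mulrAC ler_pdivlMr // mul1r.
have P0 : 0 <= P by apply: sumr_ge0.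
have lx0 : 0 <= ln x by rewrite ln_ge0 //; lra.
have a0 : 0 <= x / y by rewrite divr_ge0 ?ltW.
have b0 : 0 <= x * ln x / y by rewrite mulrAC mulr_ge0.
have s0 : 0 <= Num.sqrt x by rewrite sqrtr_ge0.
have b1 : x / y * ln x = x * ln x / y by rewrite mulrAC.
rewrite b1 in S3.
apply: le_trans (lerD (lerD (lerD S1 S2) S3) S4) _.
rewrite -!(mulrA _ x W); clear S1 S2 S3 S4 sqW; clearbody P; move: WB.
move: (x * ln x / y) (x / y) (x * ln y ^+ 2 / y) (x * W) (Num.sqrt x) a0 b0 s0.
by move=> b a l v s a0 b0 s0 WB; lra.
Qed.
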